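(* For every integer $\alpha\geq 2$, the number $$N_\alpha:=1+\max_{L>1}\frac{(2\alpha+1)L}{(L-1)^{2\alpha+1}+1}$$ is irrational.
   Context: The maximum is over real $L>1$ and is attained. Equivalently, $N_\alpha=1+|m_\alpha+1|^{2\alpha}$, where $m_\alpha$ is the unique solution in $[-3,-2]$ of $(m+1)|m+1|^{2\alpha}-\big((2\alpha+1)m+1\big)=0$. *)

(* Defs.v *)
From mathcomp Require Import all_boot all_order all_algebra.
From mathcomp Require Import all_classical all_reals all_analysis.
From mathcomp Require Import ring lra.

Set Implicit Arguments.
Unset Strict Implicit.
Unset Printing Implicit Defensive.

Import Order.TTheory GRing.Theory Num.Theory.
Import numFieldNormedType.Exports.
Local Open Scope classical_set_scope.
Local Open Scope ring_scope.

Section Maximum.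
Variable R : realType.

Definition is_max (A : set R) (M : R) : Prop := A M /\ ubound A M.

(* The maximum of A; the default value 0 is only used when A has none. *)
Definition max_set (A : set R) : R := xget 0 [set M | is_max A M].

Lemma is_max_unique (A : set R) (M N : R) : is_max A M -> is_max A N -> M = N.
Proof.
move=> [AM ubM] [AN ubN]; apply/le_anti/andP; split; first exact: ubN.
exact: ubM.
Qed.

Lemma max_setP (A : set R) (M : R) : is_max A M -> max_set A = M.
Proof.
by move=> AM; apply: xget_unique => // y Ay; exact: is_max_unique Ay AM.
Qed.

End Maximum.

Section Nalpha.
Variable R : realType.

Definition objective (alpha : nat) (L : R) : R :=
  (2 * alpha + 1)%:R * L / ((L - 1) ^+ (2 * alpha + 1) + 1).

Definition Nalpha (alpha : nat) : R :=
  1 + max_set [set objective alpha L | L in [set L : R | 1 < L]].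

Lemma objective_den_gt0 (alpha : nat) (L : R) :
  1 <= L -> 0 < (L - 1) ^+ (2 * alpha + 1) + 1.
Proof. by move=> L1; rewrite ltr_wpDl// exprn_ge0// subr_ge0. Qed.

Lemma objective1 (alpha : nat) : objective alpha 1 = (2 * alpha + 1)%:R.
Proof. by rewrite /objective subrr expr0n addn1 /= add0r mulr1 divr1. Qed.

Lemma objective2 (alpha : nat) : objective alpha 2 = (2 * alpha + 1)%:R.
Proof.
rewrite /objective (_ : 2 - 1 = 1 :> R); last by ring.
by rewrite expr1n (_ : 1 + 1 = 2 :> R)// mulfK ?pnatr_eq0.
Qed.

Lemma objective_ge2 (alpha : nat) (L : R) :
  2 <= L -> objective alpha L <= (2 * alpha + 1)%:R.
Proof.
move=> L2; rewrite /objective ler_pdivrMr; last by apply: objective_den_gt0; lra.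
rewrite ler_wpM2l// -lerBlDr.
have L1 : 1 <= L - 1 by lra.
by rewrite addn1 exprS ler_peMr ?exprn_ege1//; lra.
Qed.

Lemma objective_continuous (alpha : nat) (L : R) :
  1 <= L -> {for L, continuous (objective alpha)}.
Proof.
move=> L1; apply: cvgM; first by apply: cvgM; [exact: cvg_cst|exact: cvg_id].
apply: cvgV; first by rewrite gt_eqF// objective_den_gt0.
apply: cvgD; last exact: cvg_cst.
apply: (@continuous_comp _ _ _ (fun x : R => x - 1) (fun y => y ^+ _));
  last exact: exprn_continuous.
by apply: cvgB; [exact: cvg_id|exact: cvg_cst].
Qed.

(* EVT_max on [1, 2] suffices: objective takes the value 2 * alpha + 1 at both
   1 and 2, and is at most that beyond 2. *)
Lemma objective_max_attained (alpha : nat) : exists M : R,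
  is_max [set objective alpha L | L in [set L : R | 1 < L]] M.
Proof.
have ct : {within `[1, 2], continuous (objective alpha : R -> R)}.
  apply: continuous_in_subspaceT => x /set_mem /=; rewrite in_itv /= => /andP[x1 _].
  exact: objective_continuous.
have le12 : (1 : R) <= 2 by lra.
have [c c12 cmax] := EVT_max le12 ct.
have [c1 c2] : 1 <= c /\ c <= 2 by move: c12; rewrite in_itv /= => /andP[].
have c2le : objective alpha 2 <= objective alpha c by apply: cmax; rewrite in_itv /= lexx andbT.
exists (objective alpha c); split => [|_ [L /= L1 <-]].
  have [c_gt1|] := ltP 1 c; first by exists c.
  move=> cle1; have -> : c = 1 by apply/le_anti/andP.
  by exists 2; rewrite /= ?objective1 ?objective2//; lra.
have [L2|L2] := ltP 2 L.
  by apply: le_trans c2le; rewrite objective2; apply: objective_ge2; exact: ltW.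
by apply: cmax; rewrite in_itv /=; apply/andP; split; lra.
Qed.

Lemma Nalpha_is_max (alpha : nat) :
  is_max [set objective alpha L | L in [set L : R | 1 < L]] (Nalpha alpha - 1).
Proof.
have [M MP] := objective_max_attained alpha.
by rewrite /Nalpha (max_setP MP) addrC addrA addNr add0r.
Qed.

End Nalpha.

(* Main.v *)
Require Import Defs.
From mathcomp Require Import all_boot all_order all_algebra.
From mathcomp Require Import all_classical all_reals all_analysis.
From mathcomp Require Import zify ring lra.

(* Write k = 2 alpha + 1 and M = N_alpha - 1, attained at L = 1 + t. The
   polynomial M (u^k + 1) - k (u + 1) is nonnegative for u > 0 and vanishes at t,
   so its derivative vanishes there too: M t^(k-1) = 1. Feeding this back into
   M (t^k + 1) = k (t + 1) gives (k - 1) t = M - k, so if M is rational then so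
   is t, which moreover satisfies (k - 1) t^k + k t^(k-1) = 1. If t = a / b in
   lowest terms, a divides b^k, so a = 1 and b^k = k b + k - 1; this has no
   solution for k >= 4 (for k = 3 it has b = 2, whence alpha >= 2). *)

Set Implicit Arguments.
Unset Strict Implicit.
Unset Printing Implicit Defensive.

Import Order.TTheory GRing.Theory Num.Theory.
Import numFieldNormedType.Exports.
Local Open Scope ring_scope.

Lemma ltn_mul3_exp2 (k : nat) : (4 <= k)%N -> (3 * k < 2 ^ k)%N.
Proof.
elim: k => // k IH; rewrite leq_eqVlt => /predU1P[<-//|k4]; have := IH k4; rewrite expnS; lia.
Qed.

Lemma expn_neq_mulnDpred (k b : nat) :
  (4 <= k)%N -> (b ^ k)%N <> (k * b + k.-1)%N.
Proof.
move=> k4; case: b => [|[|b]]; rewrite ?exp1n ?exp0n; try lia.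
(* As [b.+2] is at least 2, [k * b.+2 + k.-1] is less than three halves of [k * b.+2]. *)
suff: (3 * k * b.+2 <= 2 * b.+2 ^ k)%N by nia.
case: k k4 => // k k4; rewrite (expnS b.+2) [X in (_ <= X)%N]mulnCA mulnC leq_mul2l /=.
apply: leq_trans (ltnW (ltn_mul3_exp2 k4)) _.
by rewrite expnS leq_mul2l leq_exp2r; lia.
Qed.

(** The equation [(k - 1) t^k + k t^(k-1) = 1] at [t = a / b], multiplied by [b^k]. *)
Lemma coprime_trinomial_neq (k a b : nat) : (4 <= k)%N -> coprime a b ->
  (k.-1 * a ^ k + k * a ^ k.-1 * b)%N <> (b ^ k)%N.
Proof.
move=> k4 cab E.
have a1 : a = 1%N.
  apply/eqP; rewrite -[_ == _](dvdn1 a) -(@Gauss_dvdl _ _ (b ^ k)); last exact: coprimeXr.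
  rewrite mul1n -E; case: k k4 {E} => [|[|k]]// _ /=.
  by rewrite !expnS dvdn_add// ?[(_ * b)%N]mulnAC; apply/dvdn_mull/dvdn_mulr.
by move: E; rewrite a1 !exp1n !muln1 addnC => /esym; exact: expn_neq_mulnDpred.
Qed.

Lemma rat_trinomial_neq (k : nat) (t : rat) : (4 <= k)%N -> 0 < t ->
  k.-1%:R * t ^+ k + k%:R * t ^+ k.-1 <> 1.
Proof.
move=> k4 t0 E.
have n0 : 0 < numq t by rewrite numq_gt0.
apply: (coprime_trinomial_neq k4 (coprime_num_den t)).
apply/eqP; rewrite -(eqr_nat rat) natrD !natrM !natrX !natr_absz.
rewrite (gtr0_norm n0) (gtr0_norm (denq_gt0 t)).
rewrite numqE; move: E; case: k k4 => // k _ /= E.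
apply/eqP; rewrite -[RHS]mul1r -[X in _ = X * _]E.
by rewrite !exprMn !exprS; ring.
Qed.

Lemma max_objective_critical (R : realType) (k : nat) (M t : R) : (0 < k)%N ->
  0 < t -> M * (t ^+ k + 1) = k%:R * (t + 1) ->
  (forall u, 0 < u -> k%:R * (u + 1) <= M * (u ^+ k + 1)) ->
  M * t ^+ k.-1 = 1.
Proof.
move=> k0 t0 Mt Mub.
pose p : {poly R} := M *: ('X^k + 1) - k%:R *: ('X + 1).
have pE u : p.[u] = M * (u ^+ k + 1) - k%:R * (u + 1) by rewrite /p !hornerE.
have dp : is_derive t (1 : R) (horner p) 0.
  (* [p] is nonnegative on []0, t + 1[] and vanishes at the interior point [t]. *)
  apply: (@derive1_at_min _ _ 0 (t + 1)); first lra.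
  - by move=> u _; exact: derivable_horner.
  - by rewrite in_itv /= t0; lra.
  move=> u; rewrite in_itv /= => /andP[u0 _].
  by rewrite !pE Mt subrr subr_ge0 Mub.
have := @derive_val _ _ _ _ _ _ _ dp.
rewrite (@derive_val _ _ _ _ _ _ _ (is_derive_poly p t)).
rewrite /p derivB !derivZ !derivD derivXn derivX !derivC !hornerE /=.
rewrite hornerMn hornerXn => /eqP; rewrite subr_eq0 => /eqP crit.
have k_neq0 : (k%:R : R) != 0 by rewrite pnatr_eq0 -lt0n.
by apply: (mulfI k_neq0); rewrite mulrCA mulr1 mulr_natl.
Qed.

Theorem mainTheorem3 (R : realType) (alpha : nat) (halpha : (2 <= alpha)%N) :
  irrational (Nalpha R alpha).
Proof.
have [[L /= L1 ML] ub] := Nalpha_is_max R alpha.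
move: (Nalpha R alpha) ML ub => N; set k := (2 * alpha + 1)%N => ML ub.
have k4 : (4 <= k)%N by rewrite /k; lia.
set t := L - 1; have t0 : 0 < t by rewrite /t; lra.
have Mt : (N - 1) * (t ^+ k + 1) = k%:R * (t + 1).
  rewrite -ML /objective -/k -/t divfK ?subrK// gt_eqF//.
  by apply: objective_den_gt0; exact: ltW.
have Mub u : 0 < u -> k%:R * (u + 1) <= (N - 1) * (u ^+ k + 1).
  move=> u0; have L' : 1 < u + 1 by lra.
  rewrite -ler_pdivrMr; last by rewrite addr_gt0// exprn_gt0.
  by apply: ub; exists (u + 1); rewrite //= /objective addrK.
have crit : (N - 1) * t ^+ k.-1 = 1.
  by apply: (max_objective_critical _ t0 Mt Mub); lia.
have k_gt0 : (0 < k)%N by rewrite (leq_trans _ k4).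
have tk : t ^+ k = t * t ^+ k.-1 by rewrite -exprS prednK.
have tN : k.-1%:R * t = N - 1 - k%:R.
  have k1 : k%:R = k.-1%:R + 1 :> R by rewrite natr1 prednK.
  (* By [crit], [(N - 1) * t ^+ k] is [t], so [Mt] becomes linear in [t]. *)
  move: Mt; rewrite tk mulrDr mulrCA crit k1; lra.
(* [r] is [tN] solved for [t], with the rational [q] in place of [N]. *)
move=> [q _ qN]; pose r : rat := (q - 1 - k%:R) / k.-1%:R.
have k1 : k.-1%:R != 0 :> R by rewrite pnatr_eq0 -lt0n -ltnS prednK// (leq_trans _ k4).
have rt : ratr r = t.
  by rewrite /r fmorph_div/= !rmorphB/= rmorph1 !ratr_nat qN -tN mulrAC divff ?mul1r.
apply: (@rat_trinomial_neq k r k4); first by rewrite -(ltr0q R) rt.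
apply: (fmorph_inj (@ratr R)).
rewrite rmorphD !rmorphM !rmorphXn/= rmorph1 !ratr_nat rt -[RHS]crit.
(* By [tN], the left side is [(N - 1 - k + k) * t ^+ k.-1], the left side of [crit]. *)
by rewrite tk mulrA tN; ring.
Qed.
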